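(* Let $\mathcal{Q},\mathcal{S}$ be finite sets, $P_{\mathbf{Q},S}$ a probability distribution on $\mathcal{Q}\times\mathcal{S}$ with all marginal probabilities $P_{\mathbf{Q}}(\mathbf{q})$ and $P_S(s)$ positive, $\ell\in\{1,\dots,|\mathcal{S}|\}$, $\delta\in(0,1)$, $t\ge 2$ an integer, and $p\in(0,p_\ell]$ with $p<1$, where $p_i$ denotes the $i$-th largest value among $\{P_S(s):s\in\mathcal{S}\}$. Let $\overline{\mathcal{Q}}$ be any partition of $\mathcal{Q}$ into equivalence classes such that $|\{s\in\mathcal{S}:P(\overline{\mathbf{q}},s)\ge p\}|\ge\ell$ for every $\overline{\mathbf{q}}\in\overline{\mathcal{Q}}$, where $P(\overline{\mathbf{q}},s)=\sum_{\mathbf{q}\in\overline{\mathbf{q}}}P_{\mathbf{Q},S}(\mathbf{q},s)$, and let $$m:=\min\left\{|\mathcal{Q}|,\ \frac{1}{\ell p},\ \frac{\sum_{i=\ell}^{|\mathcal{S}|}p_i}{p}\right\},\qquad N:=\left\lceil\frac{\ln(m\ell/\delta)}{\ln(1/(1-p))}\right\rceil .$$ Let $\mathcal{D}_1,\dots,\mathcal{D}_t$ be random datasets, each consisting of $N$ i.i.d. samples from $P_{\mathbf{Q},S}$, and let $\overline{\mathcal{D}}_1,\dots,\overline{\mathcal{D}}_t$ be obtained from them by generalizing each quasi-identifier to its class in the common partition $\overline{\mathcal{Q}}$. Then the overall post-linkage dataset $\overline{\mathcal{D}}_{[t]}:=\bigcup_{\mathbf{q}\in\mathcal{Q}}\overline{\mathcal{D}}^{(\mathbf{q})}_{[t]}$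 satisfies $(\ell,t\delta)$-diversity; that is, the probability that some $\overline{\mathcal{D}}^{(\mathbf{q})}_{[t]}$, $\mathbf{q}\in\mathcal{Q}$, fails $\ell$-diversity is at most $t\delta$.
   Context: A dataset of size $N$ is a list of records $(\mathbf{q}_i,s_i)\in\mathcal{Q}\times\mathcal{S}$, $i=1,\dots,N$, with quasi-identifier $\mathbf{q}_i$ and sensitive attribute $s_i$. For an anonymized dataset $\overline{\mathcal{D}}_j$ and a class $\overline{\mathbf{q}}\in\overline{\mathcal{Q}}$, let $n_j^{(\overline{\mathbf{q}})}(s)$ be the number of records in $\mathcal{D}_j$ with quasi-identifier in $\overline{\mathbf{q}}$ and sensitive attribute $s$. For $\mathbf{q}\in\mathcal{Q}$ lying in the class $\overline{\mathbf{q}}\in\overline{\mathcal{Q}}$, put $n^{(\mathbf{q})}_{[t]}(s):=\min_{1\le j\le t}n_j^{(\overline{\mathbf{q}})}(s)$. The post-linkage dataset $\overline{\mathcal{D}}^{(\mathbf{q})}_{[t]}$ consists of $n^{(\mathbf{q})}_{[t]}(s)$ records with sensitive attribute $s$ for each $s\in\mathcal{S}$, all belonging to one equivalence class. A dataset satisfies $\ell$-diversity here if every equivalence class containing at least one record contains records with at least $\ell$ distinct sensitive attributes. A (random) collection of datasets obeys $(\ell,\delta')$-diversity if the event that some dataset in the collection fails $\ell$-diversity has probability at most $\delta'$. Within each dataset the $N$ samples are i.i.d.; it is assumed that at least one user is common to all $t$ datasets (contributing the same record to each), so no independence between different datasets is assumed. *)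

(* Defs.v *)
From HB Require Import structures.
From mathcomp Require Import all_boot all_order all_algebra.
From mathcomp Require Import all_classical all_reals all_analysis.
Set Implicit Arguments.
Unset Strict Implicit.
Unset Printing Implicit Defensive.
Import Order.TTheory GRing.Theory Num.Theory.
Local Open Scope ring_scope.

Section Distribution.
Context {R : realType} {Q S : finType} (PQS : Q * S -> R).

Definition is_distribution : Prop :=
  (forall x, 0 <= PQS x) /\ \sum_x PQS x = 1.

Definition marginalQ (q : Q) : R := \sum_s PQS (q, s).

Definition marginalS (s : S) : R := \sum_q PQS (q, s).

Definition class_prob (B : {set Q}) (s : S) : R := \sum_(q in B) PQS (q, s).

(* Values are counted with multiplicity, and the index i starts at 1. *)
Definition nth_largest (f : S -> R) (i : nat) : R :=
  nth 0 (sort (fun x y => y <= x) [seq f s | s <- enum S]) i.-1.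

End Distribution.

(* The finite type E carries its discrete sigma-algebra. *)
Definition iid_samples {d : measure_display} {T : measurableType d}
    {R : realType} (P : probability T R) {E : finType} (law : E -> R)
    (n : nat) (X : 'I_n -> T -> E) : Prop :=
  [/\ forall i (A : set E), measurable (X i @^-1` A)%classic,
      forall i x, P [set w | X i w = x]%classic = (law x)%:E
    & forall (J : {set 'I_n}) (A : 'I_n -> set E),
        P [set w | forall i, i \in J -> A i (X i w)]%classic =
        (\prod_(i in J) P (X i @^-1` A i)%classic)%E].

Section Anonymization.
Context {Q S : finType}.

(* A class of quasi-identifiers is the set of its members. *)
Definition anonymize (Qbar : {set {set Q}}) (N : nat)
    (D : N.-tuple (Q * S)) : N.-tuple ({set Q} * S) :=
  map_tuple (fun r => (finset.pblock Qbar r.1, r.2)) D.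

Definition class_count (D : seq ({set Q} * S)) (B : {set Q}) (s : S) : nat :=
  count_mem (B, s) D.

Lemma class_count_anonymize (Qbar : {set {set Q}}) (N : nat)
    (D : N.-tuple (Q * S)) (B : {set Q}) (s : S) :
  finset.partition Qbar [set: Q]%SET -> B \in Qbar ->
  class_count (anonymize Qbar D) B s =
  count (fun r => (r.1 \in B) && (r.2 == s)) D.
Proof.
case/and3P=> /eqP covQ trivQ _ BQ; rewrite /class_count /= count_map.
apply: eq_count => -[q s'] /=; rewrite xpair_eqE; congr (_ && _).
apply/eqP/idP => [<-|qB]; last exact: finset.def_pblock.
by rewrite finset.mem_pblock covQ finset.in_setT.
Qed.

(* The unit N of the iterated minimum is harmless: no count exceeds N. *)
Definition min_count (t N : nat) (D : 'I_t -> N.-tuple ({set Q} * S))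
    (B : {set Q}) (s : S) : nat :=
  \big[minn/N]_(j < t) class_count (D j) B s.

Definition post_linkage (Qbar : {set {set Q}}) (t N : nat)
    (D : 'I_t -> N.-tuple ({set Q} * S)) (q : Q) : seq ({set Q} * S) :=
  let B := finset.pblock Qbar q in
  flatten [seq nseq (min_count D B s) (B, s) | s <- enum S].

(* The union over q is kept as the collection of its members, to which
   (ell, delta)-diversity applies. *)
Definition overall_post_linkage (Qbar : {set {set Q}}) (t N : nat)
    (D : 'I_t -> N.-tuple ({set Q} * S)) : seq (seq ({set Q} * S)) :=
  [seq post_linkage Qbar D q | q <- enum Q].

Definition diverse (ell : nat) (D : seq ({set Q} * S)) : bool :=
  [forall B : {set Q}, (B \in [seq r.1 | r <- D]) ==>
     (ell <= #|[set s | (B, s) \in D]%SET|)%N].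

Definition obeys_diversity {d : measure_display} {T : measurableType d}
    {R : realType} (P : probability T R) (ell : nat) (delta : R)
    (coll : T -> seq (seq ({set Q} * S))) : Prop :=
  (P [set w | exists2 D, D \in coll w & ~~ diverse ell D]%classic
     <= delta%:E)%E.

End Anonymization.

(* Main.v *)
(** For every class B fix a set G B of exactly ell values s with P(B, s) >= p.
    If every record type (B, s) with s in G B occurs in every dataset, all the
    minimum counts at these types are positive and each post-linkage dataset is
    diverse.  A given type is missing from a given dataset with probability
    (1 - P(B, s))^N <= (1 - p)^N, so the union bound over the datasets, the
    classes and the sets G B gives t |Qbar| ell (1 - p)^N, without any
    independence between datasets.  The choice of N makes (1 - p)^N at most
    delta / (m ell), so it remains to see that |Qbar| <= m.  The first two terms
    of m are immediate.  For the third one, discard the ell - 1 most likely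
    values of s: every class keeps at least one s with P(B, s) >= p, and summing
    over the classes bounds |Qbar| p by the mass of the remaining values. *)
Require Import Defs.
From HB Require Import structures.
From mathcomp Require Import all_boot all_order all_algebra.
From mathcomp Require Import all_classical all_reals all_analysis.
Import Order.TTheory GRing.Theory Num.Theory.
Local Open Scope ring_scope.

(** * Events determined by finitely many finite-valued variables *)

Section Measure.
Context {d : measure_display} {T : measurableType d} {R : realType}.
Context (P : probability T R).

(** The event is a finite union, over the functions [f] satisfying [A], of finite intersections of
    preimages of points; hence [A] may be arbitrary. *)
Lemma measurable_finite_valued {I E : finType} (X : I -> T -> E)
    (A : {ffun I -> E} -> Prop) :
  (forall i (B : set E), measurable (X i @^-1` B)%classic) ->
  measurable [set w | A [ffun i => X i w]]%classic.
Proof.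
move=> mX.
rewrite (_ : [set w | _]%classic =
  (\bigcup_(f in [set f | A f]) \bigcap_(i in [set: I]) (X i @^-1` [set f i]))%classic).
  apply: fin_bigcup_measurable => [|f _]; first exact: finite_finset.
  by apply: fin_bigcap_measurable => [|i _]; [exact: finite_finset|exact: mX].
apply/seteqP; split=> [w Aw|w [f Af fw]] /=.
  by exists [ffun i => X i w] => // i _ /=; rewrite ffunE.
by rewrite (_ : [ffun i => _] = f)//; apply/ffunP => i; rewrite ffunE; exact: fw.
Qed.

Lemma probability_preimage {E : finType} (X : T -> E) (law : E -> R) (A : {set E}) :
  (forall B : set E, measurable (X @^-1` B)%classic) ->
  (forall x, P [set w | X w = x]%classic = (law x)%:E) ->
  P (X @^-1` [set` A])%classic = (\sum_(x in A) law x)%:E.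
Proof.
move=> mX lawX.
rewrite (_ : (X @^-1` _)%classic =
  (\bigcup_(x in [set` A]) [set w | X w = x])%classic); last first.
  apply/seteqP; split=> [w /= Xw|w [x /= xA Xwx]]; last by rewrite Xwx.
  by exists (X w).
rewrite measure_fin_bigcup//; first last.
- by move=> x _; exact: (mX [set x]%classic).
- by apply/trivIsetP => x y _ _ xy; apply/seteqP; split=> // w [xw yw]; case/eqP: xy; rewrite -xw -yw.
rewrite -sumEFin -(@bigfs _ _ _ _ (index_enum E))//; last 2 first.
- exact: index_enum_uniq.
- by move=> x _; rewrite mem_index_enum.
by apply: eq_big => [x|x _]; [|exact: lawX].
Qed.

Lemma union_bound {I : finType} (A : {pred I}) (F : I -> set T) (B : set T) (c : R) :
  (forall i, i \in A -> measurable (F i)) -> measurable B ->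
  (forall w, B w -> exists2 i, i \in A & F i w) ->
  (forall i, i \in A -> (P (F i) <= c%:E)%E) ->
  (P B <= (#|A|%:R * c)%:E)%E.
Proof.
move=> mF mB BF Fc.
have -> : (#|A|%:R * c)%:E = (\sum_(i in A) c%:E)%E.
  by rewrite sumEFin sumr_const mulr_natl.
apply: (@le_trans _ _ (\sum_(i in A) P (F i))%E); last exact: lee_sum.
rewrite (@bigfs _ _ _ _ (index_enum I)) ?index_enum_uniq//; last first.
  by move=> i _; rewrite mem_index_enum.
exact: content_sub_fsum.
Qed.

(** Independence, taken at the full index set with the complement of [A] at every index, gives a
    product of [n] equal factors. *)
Lemma iid_avoid {E : finType} (law : E -> R) (n : nat) (X : 'I_n -> T -> E)
    (A : {set E}) :
  iid_samples P law X ->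
  P [set w | forall i, X i w \notin A]%classic = ((1 - \sum_(x in A) law x) ^+ n)%:E.
Proof.
case=> mX lawX indep.
rewrite (_ : [set w | _]%classic =
  [set w | forall i, i \in [set: 'I_n]%SET -> (~` [set` A])%classic (X i w)]%classic); last first.
  apply/seteqP; split=> w /= h i; first by move=> _ XA; have := h i; rewrite XA.
  by apply/negP => XA; apply: (h i) XA; rewrite finset.in_setT.
rewrite (indep _ (fun=> ~` [set` A])%classic).
rewrite (eq_bigr (fun=> (1 - \sum_(x in A) law x)%:E)) => [|i _].
  by rewrite prodEFin prodr_const cardsT card_ord.
rewrite preimage_setC probability_setC; last exact: (mX i [set` A]%classic).
by rewrite EFinB; congr (_ - _)%E; exact: probability_preimage.
Qed.

End Measure.

(** Sorting the elements of [S] by [f], instead of the values, turns a tail of the sorted values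
    into a sum over a set: [U] collects the first [n - 1] elements, or all of [S] if there are
    fewer. *)
Lemma sum_nth_largest {R : realType} {S : finType} (f : S -> R) (n : nat) :
  (1 <= n)%N ->
  exists U : {set S}, (#|U| < n)%N /\
    \sum_(n <= i < #|S|.+1) nth_largest f i = \sum_(s in ~: U) f s.
Proof.
case: n => // n _; rewrite /nth_largest sort_map.
set r := sort _ (enum S).
have rS : size r = #|S| by rewrite size_sort -cardE.
have uniq_r : uniq r by rewrite sort_uniq enum_uniq.
have mem_r s : s \in r by rewrite mem_sort mem_enum.
exists [set s in take n r]%SET; split.
  rewrite ltnS cardsE; apply: leq_trans (card_size _) _.
  by rewrite size_take; case: ltnP.
rewrite big_add1 /=.
have [leSn|ltnS] := leqP #|S| n.
  rewrite big_geq// big_pred0// => s.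
  by rewrite !inE take_oversize ?rS// mem_r.
transitivity (\sum_(s <- drop n r) f s).
  rewrite -[RHS](big_map f xpredT id) map_drop [RHS](big_nth 0).
  rewrite size_drop size_map rS -{1}[n]add0n big_addn.
  by apply: eq_bigr => i _; rewrite nth_drop addnC.
rewrite big_uniq ?drop_uniq//; apply: eq_bigl => s.
rewrite !inE; have := mem_r s; have := uniq_r.
rewrite -{1 2}[r](cat_take_drop n) cat_uniq mem_cat => /and3P[_ /hasPn nh _].
by case: (boolP (s \in drop n r)) => [/nh ->|_]; rewrite ?orbF// => ->.
Qed.

(** * Bounds on the number of classes *)

Section Classes.
Context {R : realType} {Q S : finType} (PQS : Q * S -> R).
Context (hPQS : is_distribution PQS) (Qbar : {set {set Q}}).
Context (hQbar : finset.partition Qbar [set: Q]%SET).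

Lemma class_prob_ge0 B s : 0 <= class_prob PQS B s.
Proof. by apply: sumr_ge0 => q _; case: hPQS. Qed.

Lemma class_probE B s :
  class_prob PQS B s = \sum_(x in finset.setX B [set s]%SET) PQS x.
Proof.
transitivity (\sum_(q in B) \sum_(s' in [set s]%SET) PQS (q, s')).
  by apply: eq_bigr => q _; rewrite big_set1.
rewrite pair_big /=; apply: eq_big => [[q s']|[]//].
by rewrite !inE.
Qed.

Lemma class_prob_le1 B s : class_prob PQS B s <= 1.
Proof.
case: hPQS => PQS0 <-; rewrite class_probE.
rewrite [leRHS](bigID (mem (finset.setX B [set s]%SET)))/= lerDl.
by apply: sumr_ge0 => x _; exact: PQS0.
Qed.

Lemma sum_class_prob s : \sum_(B in Qbar) class_prob PQS B s = marginalS PQS s.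
Proof.
rewrite /class_prob -(finset.big_trivIset _ (E := fun q => PQS (q, s)))/=; last by case/and3P: hQbar.
rewrite (finset.cover_partition hQbar).
by apply: eq_bigl => q; rewrite finset.in_setT.
Qed.

Lemma sum_marginalS : \sum_s marginalS PQS s = 1.
Proof.
case: hPQS => _ <-; rewrite /marginalS exchange_big pair_big /=.
by apply: eq_bigr => -[].
Qed.

(** Double counting of the mass on [V]: each class contributes at least [k * p]. The second bound on
    [#|Qbar|] takes all of [S] with [k = ell], the third a complement with [k = 1]. *)
Lemma class_card_bound (V : {set S}) (k : nat) (p : R) : 0 <= p ->
  (forall B, B \in Qbar -> (k <= #|[set s in V | (p <= class_prob PQS B s)%R]%SET|)%N) ->
  #|Qbar|%:R * (k%:R * p) <= \sum_(s in V) marginalS PQS s.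
Proof.
move=> p0 hk; rewrite (eq_bigr _ (fun s _ => esym (sum_class_prob s))).
rewrite exchange_big /= mulr_natl -sumr_const; apply: ler_sum => B BQ.
rewrite (big_setID [set s | p <= class_prob PQS B s]%SET)/=.
rewrite -[leLHS]addr0 lerD//; last by apply: sumr_ge0 => s _; exact: class_prob_ge0.
apply: (@le_trans _ _ (\sum_(s in V :&: [set s | (p <= class_prob PQS B s)%R]%SET) p)).
  rewrite sumr_const -[leRHS]mulr_natl ler_wpM2r// ler_nat.
  apply: leq_trans (hk _ BQ) (subset_leq_card _).
  by apply/fintype.subsetP => s; rewrite !inE.
by apply: ler_sum => s; rewrite !inE => /andP[].
Qed.

(** Without classes every marginal would vanish, against total mass 1. *)
Lemma card_classes_gt0 : (0 < #|Qbar|)%N.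
Proof.
rewrite lt0n cards_eq0; apply/eqP => Q0.
have := oner_neq0 R; rewrite -sum_marginalS big1 ?eqxx// => s _.
by rewrite -sum_class_prob Q0 big_set0.
Qed.

Lemma card_classes_le (ell : nat) (p : R) : (1 <= ell)%N -> 0 < p ->
  (forall B, B \in Qbar -> (ell <= #|[set s | (p <= class_prob PQS B s)%R]%SET|)%N) ->
  #|Qbar|%:R <= Num.min (#|Q|%:R)
                (Num.min (1 / (ell%:R * p))
                   ((\sum_(ell <= i < #|S|.+1)
                       nth_largest (marginalS PQS) i) / p)).
Proof.
move=> l0 p0 hl; rewrite !le_min; apply/and3P; split.
- have := card_partition hQbar; rewrite cardsT => ->; rewrite ler_nat -sum1_card.
  apply: leq_sum => B BQ; rewrite card_gt0.
  by apply: contraTneq BQ => ->; case/and3P: hQbar.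
- rewrite ler_pdivlMr ?mulr_gt0 ?ltr0n// -[leRHS]sum_marginalS.
  rewrite [leRHS](eq_bigl (fun s => s \in [set: S]%SET)) => [|s]; last by rewrite finset.in_setT.
  apply: class_card_bound => [|B BQ]; first exact: ltW.
  by apply: leq_trans (hl B BQ) (subset_leq_card _); apply/fintype.subsetP => s; rewrite !inE.
- have [U [cU ->]] := sum_nth_largest (marginalS PQS) ell l0.
  rewrite ler_pdivlMr// -[p in leLHS]mul1r; apply: (class_card_bound _ 1) => [|B BQ]; first exact: ltW.
  (* If no likely value of [B] lay outside [U], then [U] would contain at least [ell] elements. *)
  rewrite card_gt0; apply/negP => /eqP V0.
  have := leq_trans cU (hl B BQ); rewrite ltnNge subset_leq_card//.
  apply/fintype.subsetP => s; rewrite inE => ps.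
  have := finset.in_set0 s; rewrite -V0 !inE ps andbT.
  by move/negbFE.
Qed.

End Classes.

(** A ceiling is at least its argument; clearing the positive denominator and removing the
    logarithms gives [x <= (1 - p)^-1 ^+ N]. *)
Lemma pow_sample_size_le {R : realType} (p x : R) (N : nat) : 0 < p < 1 -> 0 < x ->
  N%:Z = Num.ceil (ln x / ln (1 / (1 - p))) -> (1 - p) ^+ N <= x^-1.
Proof.
move=> /andP[p0 p1] x0 hN; have q0 : 0 < 1 - p by rewrite subr_gt0.
have q1 : 1 < (1 - p)^-1 by rewrite invf_gt1// ltrBlDr ltrDl.
have := ceil_ge (ln x / ln (1 / (1 - p))); rewrite -hN div1r.
rewrite ler_pdivrMr ?ln_gt0// -pmulrn mulr_natl -lnXn ?invr_gt0//.
rewrite ler_ln ?posrE ?exprn_gt0 ?invr_gt0// exprVn => h.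
by rewrite -[leLHS]invrK lef_pV2 ?posrE ?invr_gt0 ?exprn_gt0.
Qed.

(** * A failure of diversity forces a missing record type *)

Section Diversity.
Context {Q S : finType} (Qbar : {set {set Q}}) (t N : nat).

(** The unit [N] takes part in the minimum, so it has to be positive as well. *)
Lemma min_count_gt0 (D : 'I_t -> N.-tuple ({set Q} * S)) B s : (0 < N)%N ->
  (forall j, (B, s) \in (D j : seq _)) -> (0 < min_count D B s)%N.
Proof.
move=> N0 hD; rewrite /min_count; elim/big_ind: _ => // [x y|j _].
  by rewrite leq_min => -> ->.
by rewrite /class_count -has_count has_pred1.
Qed.

Lemma post_linkage_diverse (D : 'I_t -> N.-tuple ({set Q} * S)) q (G : {set S}) :
  (0 < N)%N -> (forall j s, s \in G -> (finset.pblock Qbar q, s) \in (D j : seq _)) ->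
  diverse #|G| (post_linkage Qbar D q).
Proof.
move=> N0 hD; apply/forallP => B; apply/implyP => /mapP[[B' s']].
rewrite /post_linkage => /flatten_mapP[s0 _]; rewrite mem_nseq => /andP[_ /eqP[-> _]] /= ->.
apply/subset_leq_card/fintype.subsetP => s sG; rewrite inE.
apply/flatten_mapP; exists s; first by rewrite mem_enum.
by rewrite mem_nseq eqxx andbT min_count_gt0// => j; exact: hD.
Qed.

(** Contrapositive of [post_linkage_diverse], moved back to the raw records so that [iid_avoid]
    applies. *)
Lemma not_diverse_unseen (D : 'I_t -> N.-tuple (Q * S)) (G : {set Q} -> {set S}) (ell : nat) :
  finset.partition Qbar [set: Q]%SET -> (0 < N)%N ->
  (forall B, B \in Qbar -> #|G B| = ell) ->
  (exists2 L, L \in overall_post_linkage Qbar (fun j => anonymize Qbar (D j)) &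
     ~~ diverse ell L) ->
  exists j B s, [/\ B \in Qbar, s \in G B &
    forall i, tnth (D j) i \notin finset.setX B [set s]%SET].
Proof.
move=> hQbar N0 cG [L /mapP[q _ ->] nd].
have qQ : q \in finset.cover Qbar by rewrite (cover_partition hQbar) finset.in_setT.
have BQ : finset.pblock Qbar q \in Qbar by exact: pblock_mem.
have [] := boolP [forall j, [forall s, (s \in G (finset.pblock Qbar q)) ==>
    ((finset.pblock Qbar q, s) \in (anonymize Qbar (D j) : seq _))]].
  move=> /forallP h; case/negP: nd; rewrite -(cG _ BQ).
  apply: post_linkage_diverse => // j s sG.
  by have /forallP/(_ s)/implyP := h j; exact.
move=> /forallPn[j /forallPn[s]]; rewrite negb_imply => /andP[sG sD].
exists j, (finset.pblock Qbar q), s; split=> // i.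
apply: contra sD; rewrite inE => /andP[iB]; rewrite inE => /eqP si.
apply/mapP; exists (tnth (D j) i); first exact: mem_tnth.
case/and3P: hQbar => _ triv _.
by rewrite si (def_pblock triv BQ iB).
Qed.

End Diversity.

Theorem theorem4p5 (R : realType) (Q S : finType) (PQS : Q * S -> R)
    (hPQS : is_distribution PQS)
    (hQ : forall q, 0 < marginalQ PQS q)
    (hS : forall s, 0 < marginalS PQS s)
    (ell : nat) (hell : (1 <= ell <= #|S|)%N)
    (delta : R) (hdelta : 0 < delta < 1)
    (t : nat) (ht : (2 <= t)%N)
    (p : R) (hp0 : 0 < p) (hpell : p <= nth_largest (marginalS PQS) ell)
    (hp1 : p < 1)
    (Qbar : {set {set Q}}) (hQbar : finset.partition Qbar [set: Q]%SET)
    (hclass : forall B : {set Q}, B \in Qbar ->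
       (ell <= #|[set s | (p <= class_prob PQS B s)%R]%SET|)%N)
    (m : R)
    (hm : m = Num.min (#|Q|%:R)
                (Num.min (1 / (ell%:R * p))
                   ((\sum_(ell <= i < #|S|.+1)
                       nth_largest (marginalS PQS) i) / p)))
    (N : nat)
    (hN : N%:Z = Num.ceil (ln (m * ell%:R / delta) / ln (1 / (1 - p))))
    (d : measure_display) (T : measurableType d) (P : probability T R)
    (D : 'I_t -> T -> N.-tuple (Q * S))
    (hD : forall j, iid_samples P PQS (fun i w => tnth (D j w) i)) :
  obeys_diversity P ell (t%:R * delta)
    (fun w => overall_post_linkage Qbar (fun j => anonymize Qbar (D j w))).
Proof.
have /andP[l0 _] := hell; have /andP[d0 _] := hdelta.
have le_m : #|Qbar|%:R <= m by rewrite hm; exact: card_classes_le.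
have m0 : 0 < m.
  by apply: lt_le_trans le_m; rewrite ltr0n; exact: card_classes_gt0 hPQS _ hQbar.
have lp0 : 0 < ell%:R :> R by rewrite ltr0n.
have tailN : (1 - p) ^+ N <= (m * ell%:R / delta)^-1.
  by apply: pow_sample_size_le hN; rewrite ?hp0// divr_gt0// mulr_gt0.
(* For [N = 0] the tail bound would read [1 <= delta / (m * ell)], but [delta < 1 <= m * ell]. *)
have N0 : (0 < N)%N.
  rewrite lt0n; apply: contraTneq tailN => ->.
  rewrite expr0 invf_div -ltNge ltr_pdivrMr ?mulr_gt0// mul1r.
  apply: lt_le_trans (_ : 1 <= _); first by case/andP: hdelta.
  rewrite -[leLHS]mulr1 ler_pM// ?ler1n//.
  by apply: le_trans le_m; rewrite ler1n (card_classes_gt0 _ hPQS).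
have [G cG pG] : exists2 G : {set Q} -> {set S},
    (forall B, B \in Qbar -> #|G B| = ell) &
    (forall B s, B \in Qbar -> s \in G B -> p <= class_prob PQS B s).
  (* Stated for every [B], with the empty set outside [Qbar], so that choice yields a total
     function. *)
  have hG B : exists V : {set S}, B \in Qbar ->
      #|V| = ell /\ forall s, s \in V -> p <= class_prob PQS B s.
    have [BQ|nBQ] := boolP (B \in Qbar); last by exists finset.set0.
    have /card_geqP[r [ur sr rP]] := hclass B BQ.
    exists [set s in r]%SET => _; split.
      by rewrite cardsE (card_uniqP ur).
    by move=> s; rewrite inE => /rP; rewrite inE.
  exists (fun B => projT1 (cid (hG B))) => B; case: cid => V /= hV.
    by move=> /hV[].
  by move=> s /hV[_]; exact.
rewrite /obeys_diversity.
(* The union bound runs over triples of a dataset, a class and a selected value. *)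
pose bad := [pred k : 'I_t * ({set Q} * S) | (k.2.1 \in Qbar) && (k.2.2 \in G k.2.1)].
have card_bad : #|bad| = (t * (#|Qbar| * ell))%N.
  rewrite -[LHS]sum1_card.
  transitivity (\sum_(j < t) \sum_(x | (x.1 \in Qbar) && (x.2 \in G x.1)) 1)%N.
    by rewrite pair_big_dep.
  rewrite sum_nat_const card_ord; congr (_ * _)%N.
  rewrite -(pair_big_dep (fun B => B \in Qbar) (fun B s => s \in G B) (fun _ _ => 1%N))/=.
  rewrite -sum_nat_const; apply: eq_bigr => B BQ.
  by rewrite sum1_card cG.
apply: le_trans (union_bound P bad
  (fun k => [set w | forall i, tnth (D k.1 w) i \notin finset.setX k.2.1 [set k.2.2]%SET]%classic)
  _ ((1 - p) ^+ N) _ _ _ _) _.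
- move=> [j [B s]] _ /=; case: (hD j) => mX _ _.
  have := measurable_finite_valued (fun i w => tnth (D j w) i)
    (fun f => forall i, f i \notin finset.setX B [set s]%SET) mX.
  by congr measurable; apply/seteqP; split=> w /= h i; have := h i; rewrite ffunE.
(* The failure event is measurable because it depends only on the [t * N] samples, gathered here
   into one finite family. *)
- pose X (k : 'I_t * 'I_N) w := tnth (D k.1 w) k.2.
  have := measurable_finite_valued X (fun f => exists2 L, L \in overall_post_linkage Qbar
    (fun j => anonymize Qbar [tuple f (j, i) | i < N]) & ~~ diverse ell L)
    (fun k => let: And3 m _ _ := hD k.1 in m k.2).
  have DX w : (fun j => anonymize Qbar [tuple [ffun k => X k w] (j, i) | i < N])
      = (fun j => anonymize Qbar (D j w)).
    apply/funext => j; congr anonymize.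
    by apply: eq_from_tnth => i; rewrite tnth_mktuple ffunE.
  by congr measurable; apply/funext => w; rewrite /mkset DX.
- move=> w /(not_diverse_unseen _ _ _ _ G ell hQbar N0 cG)[j [B [s [BQ sG h]]]].
  by exists (j, (B, s)) => //; rewrite inE /= BQ.
- move=> [j [B s]] /andP[/= BQ sG].
  rewrite (iid_avoid P _ _ _ _ (hD j)) -class_probE lee_fin.
  rewrite lerXn2r ?nnegrE ?subr_ge0 ?(ltW hp1) ?class_prob_le1//.
  by rewrite lerD2l lerN2 pG.
(* What remains is [#|Qbar| * ell * (delta / (m * ell)) <= delta], which follows from [le_m]. *)
rewrite lee_fin card_bad natrM -mulrA ler_wpM2l// natrM.
apply: le_trans (ler_wpM2l _ tailN) _; first by rewrite mulr_ge0.
rewrite invf_div mulrA ler_pdivrMr ?mulr_gt0// mulrC ler_wpM2l ?(ltW d0)//.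
by rewrite ler_wpM2r// ltW.
Qed.
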